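(* Let $\Bbbk$ be a commutative ring with unit. Every ribbon Hopf algebra $(A,R,\kappa)$ over $\Bbbk$ is an XC-algebra, with universal $R$-matrix $R$ and balancing element $\kappa$.
   Context: Ribbon Hopf algebras. All Hopf algebras are assumed to have invertible antipode $S$. A quasi-triangular structure on a Hopf algebra $A$ over $\Bbbk$ is an invertible element $R=\sum_i\alpha_i\otimes\beta_i\in A\otimes A$ with $(\Delta\otimes\mathrm{id})(R)=R_{13}R_{23}$, $(\mathrm{id}\otimes\Delta)(R)=R_{13}R_{12}$ and $\Delta^{\mathrm{op}}=R\,\Delta(-)\,R^{-1}$. Its Drinfeld element is $u=\sum_iS(\beta_i)\alpha_i$, which is invertible. A ribbon structure on $(A,R)$ is an element $\kappa\in A$ with $\kappa^2=uS(u^{-1})$, $\Delta(\kappa)=\kappa\otimes\kappa$ and $S^2=\kappa\cdot(-)\cdot\kappa^{-1}$; the triple $(A,R,\kappa)$ is then called a ribbon Hopf algebra. XC-algebras. An XC-algebra over $\Bbbk$ is a $\Bbbk$-algebra $A$ with invertible elements $R=\sum_i\alpha_i\otimes\beta_i\in A\otimes A$ (with inverse $R^{-1}=\sum_i\bar\alpha_i\otimes\bar\beta_i$) and $\kappa\in A$ such that (XC0) $R^{\pm1}=(\kappa\otimes\kappa)R^{\pm1}(\kappa^{-1}\otimes\kappa^{-1})$; (XC1f) $\sum_i\beta_i\kappa\alpha_i=\sum_i\alpha_i\kappa^{-1}\beta_i$; (XC2c) $1\otimes\kappa^{-1}=\sum_{i,j}\alpha_i\bar\alpha_j\otimes\bar\beta_j\kappa^{-1}\beta_i$;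 (XC2d) $\kappa\otimes1=\sum_{i,j}\bar\alpha_j\kappa\alpha_i\otimes\beta_i\bar\beta_j$; (XC3) $R_{12}R_{13}R_{23}=R_{23}R_{13}R_{12}$. *)

(* Defs.v *)
From HB Require Import structures.
From mathcomp Require Import all_boot all_algebra.
From mathcomp Require Import generic_quotient.
From mathcomp Require Import boolp classical_sets.

Set Implicit Arguments.
Unset Strict Implicit.
Unset Printing Implicit Defensive.

Import GRing.Theory.
Local Open Scope ring_scope.
Local Open Scope quotient_scope.

Reserved Notation "c **: x" (at level 40).
Reserved Notation "x \ot y" (at level 40, left associativity).
Reserved Notation "\tsum_ ( a , b <- x ) F"
  (at level 34, F at level 41, a name, b name, x at level 50,
   format "\tsum_ ( a ,  b  <-  x )  F").

(* Associative unital algebras over a commutative ring.  The library's algType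
   excludes the zero ring, so it cannot carry A \ot B, which may vanish even
   for nonzero A and B.  As the hierarchy already joins pzRingType and lmodType
   into nonzero algebras, the k-module structure is given by its own scaling
   operation. *)
HB.mixin Record PzRing_isPzAlgebra (k : comPzRingType) A
    of GRing.PzRing A := {
  ascale : k -> A -> A;
  ascalerA : forall (c d : k) (x : A), ascale c (ascale d x) = ascale (c * d) x;
  ascale1r : left_id 1 ascale;
  ascalerDr : right_distributive ascale +%R;
  ascalerDl : forall x : A, {morph ascale^~ x : c d / c + d};
  ascalerAl : forall (c : k) (x y : A), ascale c (x * y) = ascale c x * y;
  ascalerAr : forall (c : k) (x y : A), ascale c (x * y) = x * ascale c y
}.

#[short(type="pzAlgType")]
HB.structure Definition PzAlgebra (k : comPzRingType) :=
  {A of GRing.PzRing A & PzRing_isPzAlgebra k A}.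

Notation "c **: x" := (ascale c x) : ring_scope.

Lemma ascaler0 (k : comPzRingType) (A : pzAlgType k) (c : k) :
  c **: (0 : A) = 0.
Proof. by apply: (addrI (c **: 0)); rewrite -ascalerDr !addr0. Qed.

Lemma ascale0r (k : comPzRingType) (A : pzAlgType k) (x : A) :
  (0 : k) **: x = 0.
Proof. by apply: (addrI ((0 : k) **: x)); rewrite -ascalerDl !addr0. Qed.

Lemma ascaler_sum (k : comPzRingType) (A : pzAlgType k) (I : Type)
    (r : seq I) (F : I -> A) (c : k) :
  c **: (\sum_(i <- r) F i) = \sum_(i <- r) c **: F i.
Proof. exact: (big_morph _ (ascalerDr c) (ascaler0 A c)). Qed.

Section PzInverse.
Variable A : pzRingType.

Definition is_inverse (x y : A) : Prop := x * y = 1 /\ y * x = 1.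

Definition invertible (x : A) : Prop := exists y, is_inverse x y.

(* The two-sided inverse of x; junk value x if x is not invertible. *)
Definition pzinv (x : A) : A := xget x [set y | is_inverse x y].

Lemma pzinvP x : invertible x -> is_inverse x (pzinv x).
Proof. by move=> xinv; apply: (@xgetPex _ x [set y | is_inverse x y]). Qed.

Lemma is_inverse_uniq x y z : is_inverse x y -> is_inverse x z -> y = z.
Proof. by case=> _ yx [xz _]; rewrite -[y]mulr1 -xz mulrA yx mul1r. Qed.

Lemma pzinvE x y : is_inverse x y -> pzinv x = y.
Proof. by move=> xy; apply: (is_inverse_uniq (pzinvP _) xy); exists y. Qed.

End PzInverse.

(* [:: (u1, v1); ..; (un, vn)] : seq (U * V) stands for the formal sum of the
   ui \ot vi; tensor_rel is the congruence of the free commutative monoid on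
   U * V generated by the relations of U \ot V.  Multiples and opposites of
   generators are again generators, so formal coefficients are not needed. *)
Inductive tensor_rel (k : comPzRingType) (U V : pzAlgType k) :
    seq (U * V) -> seq (U * V) -> Prop :=
| tensor_rel_refl s : tensor_rel s s
| tensor_rel_sym s t : tensor_rel s t -> tensor_rel t s
| tensor_rel_trans s t r : tensor_rel s t -> tensor_rel t r -> tensor_rel s r
| tensor_rel_cat s s' t t' :
    tensor_rel s s' -> tensor_rel t t' -> tensor_rel (s ++ t) (s' ++ t')
| tensor_rel_comm s t : tensor_rel (s ++ t) (t ++ s)
| tensor_rel_0 v : tensor_rel [:: (0, v)] [::]
| tensor_rel_addl u u' v : tensor_rel [:: (u + u', v)] [:: (u, v); (u', v)]
| tensor_rel_addr u v v' : tensor_rel [:: (u, v + v')] [:: (u, v); (u, v')]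
| tensor_rel_scale c u v : tensor_rel [:: (c **: u, v)] [:: (u, c **: v)].

Definition tensor_relb (k : comPzRingType) (U V : pzAlgType k) :
  rel (seq (U * V)) := fun s t => `[< tensor_rel s t >].

Section TensorQuotient.
Variables (k : comPzRingType) (U V : pzAlgType k).

Lemma tensor_relb_refl : reflexive (@tensor_relb k U V).
Proof. by move=> s; apply/asboolP; apply: tensor_rel_refl. Qed.

Lemma tensor_relb_sym : symmetric (@tensor_relb k U V).
Proof. by move=> s t; apply/asboolP/asboolP; apply: tensor_rel_sym. Qed.

Lemma tensor_relb_trans : transitive (@tensor_relb k U V).
Proof.
move=> t s r /asboolP st /asboolP tr; apply/asboolP.
exact: tensor_rel_trans st tr.
Qed.

Canonical tensor_equiv := EquivRel (@tensor_relb k U V)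
  tensor_relb_refl tensor_relb_sym tensor_relb_trans.

Definition tensor : Type := {eq_quot tensor_equiv}.

HB.instance Definition _ := Choice.on tensor.
HB.instance Definition _ := EqQuotient.on tensor.

End TensorQuotient.

Arguments tensor {k} (U V)%_type_scope.

Notation "U \ot V" := (tensor U V) : type_scope.

Section TensorModule.
Variables (k : comPzRingType) (U V : pzAlgType k).
Implicit Types (s t : seq (U * V)) (x y z : (U \ot V)%type).

Definition tens (u : U) (v : V) : U \ot V := \pi_(U \ot V) [:: (u, v)].
Local Notation "u \ot v" := (tens u v) : ring_scope.

Definition tensor_add x y : U \ot V := \pi_(U \ot V) (repr x ++ repr y).
Definition tensor_zero : U \ot V := \pi_(U \ot V) [::].
Definition tensor_scale (c : k) x : U \ot V :=
  \pi_(U \ot V) [seq (c **: p.1, p.2) | p <- repr x].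
Definition tensor_opp x : U \ot V := tensor_scale (-1) x.

Lemma tensor_piP s t :
  (\pi_(U \ot V) s = \pi_(U \ot V) t) <-> tensor_rel s t.
Proof.
split=> [/eqP|st]; first by rewrite eqmodE => /asboolP.
by apply/eqP; rewrite eqmodE; apply/asboolP.
Qed.

Lemma tensor_reprP s : tensor_rel (repr (\pi_(U \ot V) s)) s.
Proof. by apply/tensor_piP; rewrite reprK. Qed.

Lemma tensor_rel_map c s t : tensor_rel s t ->
  tensor_rel [seq (c **: p.1, p.2) | p <- s] [seq (c **: p.1, p.2) | p <- t].
Proof.
elim=> {s t} /=.
- by move=> s; apply: tensor_rel_refl.
- by move=> s t _; apply: tensor_rel_sym.
- by move=> s t r _ st _ tr; apply: tensor_rel_trans st tr.
- by move=> s s' t t' _ ss' _ tt'; rewrite !map_cat; apply: tensor_rel_cat.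
- by move=> s t; rewrite !map_cat; apply: tensor_rel_comm.
- by move=> v; rewrite ascaler0; apply: tensor_rel_0.
- by move=> u u' v; rewrite ascalerDr; apply: tensor_rel_addl.
- by move=> u v v'; apply: tensor_rel_addr.
- move=> d u v; rewrite ascalerA mulrC -ascalerA.
  exact: tensor_rel_scale.
Qed.

Lemma tensor_add_pi s t :
  tensor_add (\pi_(U \ot V) s) (\pi_(U \ot V) t) = \pi_(U \ot V) (s ++ t).
Proof. by apply/tensor_piP/tensor_rel_cat; apply: tensor_reprP. Qed.

Lemma tensor_scale_pi c s : tensor_scale c (\pi_(U \ot V) s) =
  \pi_(U \ot V) [seq (c **: p.1, p.2) | p <- s].
Proof. by apply/tensor_piP/tensor_rel_map/tensor_reprP. Qed.

Lemma tensor_addA : associative tensor_add.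
Proof.
elim/quotW=> s; elim/quotW=> t; elim/quotW=> r.
by rewrite (tensor_add_pi t r) (tensor_add_pi s t) !tensor_add_pi catA.
Qed.

Lemma tensor_addC : commutative tensor_add.
Proof. by move=> x y; apply/tensor_piP/tensor_rel_comm. Qed.

Lemma tensor_add0 : left_id tensor_zero tensor_add.
Proof. by elim/quotW=> s; rewrite tensor_add_pi. Qed.

Lemma tensor_scaleA c d x :
  tensor_scale c (tensor_scale d x) = tensor_scale (c * d) x.
Proof.
elim/quotW: x => s; rewrite (tensor_scale_pi d s) !tensor_scale_pi -map_comp.
by congr (\pi_(U \ot V) _); apply: eq_map => p /=; rewrite ascalerA.
Qed.

Lemma tensor_scale1 : left_id 1 tensor_scale.
Proof.
elim/quotW=> s; rewrite tensor_scale_pi; congr (\pi_(U \ot V) _).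
by rewrite -[RHS]map_id; apply: eq_map => -[u v] /=; rewrite ascale1r.
Qed.

Lemma tensor_scaleDr : right_distributive tensor_scale tensor_add.
Proof.
move=> c; elim/quotW=> s; elim/quotW=> t.
rewrite (tensor_add_pi s t) (tensor_scale_pi c s) (tensor_scale_pi c t).
by rewrite tensor_add_pi tensor_scale_pi map_cat.
Qed.

Lemma tensor_scaleDl x c d :
  tensor_scale (c + d) x = tensor_add (tensor_scale c x) (tensor_scale d x).
Proof.
elim/quotW: x => s.
rewrite (tensor_scale_pi c s) (tensor_scale_pi d s).
rewrite tensor_scale_pi tensor_add_pi.
apply/tensor_piP; elim: s => [|[u v] s IHs] /=; first exact: tensor_rel_refl.
rewrite ascalerDl -cat1s.
set ms := [seq (c **: p.1, p.2) | p <- s] in IHs *.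
set mt := [seq (d **: p.1, p.2) | p <- s] in IHs *.
apply: (@tensor_rel_trans _ _ _ _
  ([:: (c **: u, v); (d **: u, v)] ++ (ms ++ mt))).
  by apply: (tensor_rel_cat _ IHs); apply: tensor_rel_addl.
rewrite -[_ :: (ms ++ _)]/
  ([:: (c **: u, v)] ++ (ms ++ ([:: (d **: u, v)] ++ mt))).
rewrite -[[:: (c **: u, v); _]]/([:: (c **: u, v)] ++ [:: (d **: u, v)]).
rewrite -catA; apply: tensor_rel_cat; first exact: tensor_rel_refl.
rewrite !catA; apply: tensor_rel_cat; last exact: tensor_rel_refl.
exact: tensor_rel_comm.
Qed.

Lemma tensor_scale0 x : tensor_scale 0 x = tensor_zero.
Proof.
elim/quotW: x => s; rewrite tensor_scale_pi; apply/tensor_piP.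
elim: s => [|[u v] s IHs] /=; first exact: tensor_rel_refl.
rewrite ascale0r -cat1s -[X in tensor_rel _ X]cat0s.
by apply: (tensor_rel_cat _ IHs); apply: tensor_rel_0.
Qed.

Lemma tensor_addN : left_inverse tensor_zero tensor_opp tensor_add.
Proof.
move=> x; rewrite -[X in tensor_add _ X]tensor_scale1 /tensor_opp.
by rewrite -tensor_scaleDl addNr tensor_scale0.
Qed.

HB.instance Definition _ := GRing.isZmodule.Build (U \ot V)%type
  tensor_addA tensor_addC tensor_add0 tensor_addN.

End TensorModule.

Notation "u \ot v" := (tens u v) : ring_scope.

Section TensorSum.
Variables (k : comPzRingType) (U V : pzAlgType k).
Implicit Types (x y : (U \ot V)%type).

Lemma tensDl (u u' : U) (v : V) : (u + u') \ot v = u \ot v + u' \ot v.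
Proof. by rewrite [RHS]tensor_add_pi; apply/tensor_piP/tensor_rel_addl. Qed.

Lemma tensDr (u : U) (v v' : V) : u \ot (v + v') = u \ot v + u \ot v'.
Proof. by rewrite [RHS]tensor_add_pi; apply/tensor_piP/tensor_rel_addr. Qed.

Lemma tens_scale (c : k) (u : U) (v : V) : (c **: u) \ot v = u \ot (c **: v).
Proof. exact/tensor_piP/tensor_rel_scale. Qed.

(* For x = \sum_i a_i \ot b_i, the sum \sum_i f a_i b_i.  It is computed on a
   chosen representative of x; for balanced f, in particular for bilinear f, it
   does not depend on the choice (tsumE, tsumD). *)
Definition tsum (W : nmodType) (f : U -> V -> W) x : W :=
  \sum_(p <- repr x) f p.1 p.2.

Record is_balanced (W : zmodType) (f : U -> V -> W) : Prop := IsBalanced {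
  balancedDl : forall u u' v, f (u + u') v = f u v + f u' v;
  balancedDr : forall u v v', f u (v + v') = f u v + f u v';
  balanced_scale : forall (c : k) u v, f (c **: u) v = f u (c **: v)
}.

Lemma tens_sum x : x = \sum_(p <- repr x) p.1 \ot p.2.
Proof.
rewrite -[LHS]reprK; elim: (repr x) => [|[u v] s IHs]; first by rewrite big_nil.
by rewrite big_cons -IHs; apply/esym/tensor_add_pi.
Qed.

Lemma tensor_ind (P : U \ot V -> Prop) :
  P 0 -> (forall u v x, P x -> P (u \ot v + x)) -> forall x, P x.
Proof.
move=> P0 PD x; rewrite [x]tens_sum; elim: (repr x) => [|p s IHs].
  by rewrite big_nil.
by rewrite big_cons; apply: PD.
Qed.

Section Universal.
Variables (W : zmodType) (f : U -> V -> W).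
Hypothesis fbal : is_balanced f.

Lemma tsum_pi s : tsum f (\pi_(U \ot V) s) = \sum_(p <- s) f p.1 p.2.
Proof.
have f0 v : f 0 v = 0.
  by apply: (addrI (f 0 v)); rewrite -(balancedDl fbal) !addr0.
rewrite /tsum; have := tensor_reprP s.
move: (repr _) => r; elim=> {r s} //.
- by move=> s t r _ -> _ ->.
- by move=> s s' t t' _ ss' _ tt'; rewrite !big_cat /= ss' tt'.
- by move=> s t; rewrite !big_cat /= addrC.
- by move=> v; rewrite big_seq1 big_nil /= f0.
- by move=> u u' v; rewrite big_seq1 big_cons big_seq1 /= (balancedDl fbal).
- by move=> u v v'; rewrite big_seq1 big_cons big_seq1 /= (balancedDr fbal).
- by move=> c u v; rewrite !big_seq1 /= (balanced_scale fbal).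
Qed.

Lemma tsumE u v : tsum f (u \ot v) = f u v.
Proof. by rewrite tsum_pi big_seq1. Qed.

Lemma tsumD x y : tsum f (x + y) = tsum f x + tsum f y.
Proof.
rewrite -[x]reprK -[y]reprK -[_ + _]/(tensor_add _ _).
by rewrite tensor_add_pi !tsum_pi big_cat.
Qed.

End Universal.

End TensorSum.

Notation "\tsum_ ( a , b <- x ) F" := (tsum (fun a b => F) x) : ring_scope.

Section TensorAlgebra.
Variables (k : comPzRingType) (A B : pzAlgType k).
Implicit Types (x y z : (A \ot B)%type).

Definition tensor_one : A \ot B := 1 \ot 1.

Definition tensor_mul x y : A \ot B :=
  \tsum_(a, b <- x) \tsum_(a', b' <- y) (a * a') \ot (b * b').

Lemma tens_mul_balanced (a : A) (b : B) :
  is_balanced (fun a' b' => (a * a') \ot (b * b')).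
Proof.
split=> [u u' v|u v v'|c u v]; first by rewrite mulrDr tensDl.
  by rewrite mulrDr tensDr.
by rewrite -!ascalerAr tens_scale.
Qed.

Lemma tensor_mul_balanced y : is_balanced (fun (a : A) (b : B) =>
  \tsum_(a', b' <- y) (a * a') \ot (b * b')).
Proof.
split=> [u u' v|u v v'|c u v]; rewrite /tsum -?big_split;
  apply: eq_bigr => p _ /=; first by rewrite mulrDl tensDl.
  by rewrite mulrDl tensDr.
by rewrite -!ascalerAl tens_scale.
Qed.

Lemma tensor_mulE (a a' : A) (b b' : B) :
  tensor_mul (a \ot b) (a' \ot b') = (a * a') \ot (b * b').
Proof.
rewrite /tensor_mul (tsumE (tensor_mul_balanced _)).
by rewrite (tsumE (tens_mul_balanced _ _)).
Qed.

Lemma tensor_mulDl : left_distributive tensor_mul +%R.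
Proof. by move=> x x' y; apply: (tsumD (tensor_mul_balanced y)). Qed.

Lemma tensor_mulDr : right_distributive tensor_mul +%R.
Proof.
move=> x y y'; rewrite /tensor_mul [in RHS]/tsum -big_split.
by apply: eq_bigr => p _; apply: (tsumD (tens_mul_balanced p.1 p.2)).
Qed.

Lemma tensor_mul0l y : tensor_mul 0 y = 0.
Proof. by apply: (addrI (tensor_mul 0 y)); rewrite -tensor_mulDl !addr0. Qed.

Lemma tensor_mul0r x : tensor_mul x 0 = 0.
Proof. by apply: (addrI (tensor_mul x 0)); rewrite -tensor_mulDr !addr0. Qed.

Lemma tensor_mulA : associative tensor_mul.
Proof.
move=> x y z; elim/tensor_ind: x => [|a b x IHx].
  by rewrite !tensor_mul0l.
rewrite !tensor_mulDl {}IHx; congr (_ + _).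
elim/tensor_ind: y => [|a' b' y IHy].
  by rewrite tensor_mul0l !tensor_mul0r tensor_mul0l.
rewrite tensor_mulDl !tensor_mulDr tensor_mulDl {}IHy; congr (_ + _).
elim/tensor_ind: z => [|a'' b'' z IHz]; first by rewrite !tensor_mul0r.
by rewrite !tensor_mulDr {}IHz !tensor_mulE !mulrA.
Qed.

Lemma tensor_mul1l : left_id tensor_one tensor_mul.
Proof.
move=> x; elim/tensor_ind: x => [|a b x IHx]; first by rewrite tensor_mul0r.
by rewrite tensor_mulDr IHx tensor_mulE !mul1r.
Qed.

Lemma tensor_mul1r : right_id tensor_one tensor_mul.
Proof.
move=> x; elim/tensor_ind: x => [|a b x IHx]; first by rewrite tensor_mul0l.
by rewrite tensor_mulDl IHx tensor_mulE !mulr1.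
Qed.

HB.instance Definition _ := GRing.Zmodule_isPzRing.Build (A \ot B)%type
  tensor_mulA tensor_mul1l tensor_mul1r tensor_mulDl tensor_mulDr.

Lemma tens_mulE (a a' : A) (b b' : B) :
  (a \ot b) * (a' \ot b') = (a * a') \ot (b * b').
Proof. exact: tensor_mulE. Qed.

Lemma tensor_scale_tens (c : k) (a : A) (b : B) :
  tensor_scale c (a \ot b) = (c **: a) \ot b.
Proof. exact: tensor_scale_pi. Qed.

Lemma tensor_scale_zero (c : k) : tensor_scale c (0 : A \ot B) = 0.
Proof. exact: tensor_scale_pi. Qed.

Lemma tensor_scaleAl c x y :
  tensor_scale c (x * y) = tensor_scale c x * y.
Proof.
elim/tensor_ind: x => [|a b x IHx].
  by rewrite tensor_scale_zero !mul0r tensor_scale_zero.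
rewrite mulrDl !tensor_scaleDr mulrDl {}IHx; congr (_ + _).
elim/tensor_ind: y => [|a' b' y IHy]; first by rewrite !mulr0 tensor_scale_zero.
rewrite mulrDr !tensor_scaleDr mulrDr {}IHy; congr (_ + _).
by rewrite tens_mulE !tensor_scale_tens tens_mulE ascalerAl.
Qed.

Lemma tensor_scaleAr c x y :
  tensor_scale c (x * y) = x * tensor_scale c y.
Proof.
elim/tensor_ind: x => [|a b x IHx]; first by rewrite !mul0r tensor_scale_zero.
rewrite mulrDl !tensor_scaleDr mulrDl {}IHx; congr (_ + _).
elim/tensor_ind: y => [|a' b' y IHy].
  by rewrite mulr0 !tensor_scale_zero mulr0.
rewrite mulrDr !tensor_scaleDr mulrDr {}IHy; congr (_ + _).
rewrite tens_mulE !tensor_scale_tens !tens_scale tens_mulE.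
by rewrite ascalerAr.
Qed.

HB.instance Definition _ := PzRing_isPzAlgebra.Build k (A \ot B)%type
  (@tensor_scaleA k A B) (@tensor_scale1 k A B) (@tensor_scaleDr k A B)
  (@tensor_scaleDl k A B) tensor_scaleAl tensor_scaleAr.

End TensorAlgebra.

Section TensorMaps.
Variables (k : comPzRingType).

Definition tensor_map (A B A' B' : pzAlgType k)
    (f : A -> A') (g : B -> B') (x : A \ot B) : A' \ot B' :=
  \tsum_(a, b <- x) f a \ot g b.

Definition tensor_flip (A B : pzAlgType k) (x : A \ot B) : B \ot A :=
  \tsum_(a, b <- x) b \ot a.

Definition tensor_assoc (A B C : pzAlgType k) (x : A \ot (B \ot C)) :
    (A \ot B) \ot C :=
  \tsum_(a, y <- x) \tsum_(b, c <- y) (a \ot b) \ot c.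

End TensorMaps.

HB.mixin Record PzAlgebra_isBialgebra (k : comPzRingType) A
    of PzAlgebra k A := {
  comul : {rmorphism A -> A \ot A};
  counit : {rmorphism A -> k};
  comulZ : forall (c : k) (x : A), comul (c **: x) = c **: comul x;
  counitZ : forall (c : k) (x : A), counit (c **: x) = c * counit x;
  comulA : forall x : A, tensor_map comul id (comul x)
    = tensor_assoc (tensor_map id comul (comul x));
  comul_counitl : forall x : A, \tsum_(a, b <- comul x) (counit a **: b) = x;
  comul_counitr : forall x : A, \tsum_(a, b <- comul x) (counit b **: a) = x
}.

#[short(type="bialgType")]
HB.structure Definition Bialgebra (k : comPzRingType) :=
  {A of PzAlgebra k A & PzAlgebra_isBialgebra k A}.

HB.mixin Record Bialgebra_isHopfAlgebra (k : comPzRingType) A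
    of Bialgebra k A := {
  antipode : {additive A -> A};
  antipodeZ : forall (c : k) (x : A), antipode (c **: x) = c **: antipode x;
  antipodel : forall x : A,
    \tsum_(a, b <- comul x) (antipode a * b) = (counit x : k) **: 1;
  antipoder : forall x : A,
    \tsum_(a, b <- comul x) (a * antipode b) = (counit x : k) **: 1;
  antipode_bij : bijective antipode
}.

#[short(type="hopfAlgType")]
HB.structure Definition HopfAlgebra (k : comPzRingType) :=
  {A of Bialgebra k A & Bialgebra_isHopfAlgebra k A}.

Section TripleTensor.
Variables (k : comPzRingType) (A : pzAlgType k).
Implicit Types R : (A \ot A)%type.

Definition tensor12 R : (A \ot A) \ot A := R \ot 1.
Definition tensor13 R : (A \ot A) \ot A := \tsum_(a, b <- R) (a \ot 1) \ot b.
Definition tensor23 R : (A \ot A) \ot A := \tsum_(a, b <- R) (1 \ot a) \ot b.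

End TripleTensor.

Record is_quasitriangular (k : comPzRingType) (A : hopfAlgType k)
    (R : A \ot A) : Prop := IsQuasitriangular {
  qt_invertible : invertible R;
  qt_comull : tensor_map comul id R = tensor13 R * tensor23 R;
  qt_comulr : tensor_assoc (tensor_map id comul R) = tensor13 R * tensor12 R;
  qt_comul_op : forall x : A,
    tensor_flip (comul x) = R * comul x * pzinv R
}.

Definition drinfeld (k : comPzRingType) (A : hopfAlgType k)
    (R : A \ot A) : A :=
  \tsum_(a, b <- R) (antipode b * a).

(* Invertibility of the Drinfeld element is a theorem about quasi-triangular
   Hopf algebras; kappa is then invertible by ribbon_square.  Neither is
   assumed. *)
Record is_ribbon_structure (k : comPzRingType) (A : hopfAlgType k)
    (R : A \ot A) (kappa : A) : Prop := IsRibbonStructure {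
  ribbon_square :
    kappa ^+ 2 = drinfeld R * antipode (pzinv (drinfeld R));
  ribbon_grouplike : comul kappa = kappa \ot kappa;
  ribbon_antipode : forall x : A,
    antipode (antipode x) = kappa * x * pzinv kappa
}.

Record is_ribbon_hopf_algebra (k : comPzRingType) (A : hopfAlgType k)
    (R : A \ot A) (kappa : A) : Prop := IsRibbonHopfAlgebra {
  ribbon_quasitriangular : is_quasitriangular R;
  ribbon_structure : is_ribbon_structure R kappa
}.

Record is_xc_algebra (k : comPzRingType) (A : pzAlgType k)
    (R : A \ot A) (kappa : A) : Prop := IsXCAlgebra {
  xc_R_invertible : invertible R;
  xc_kappa_invertible : invertible kappa;
  xc0 : R = (kappa \ot kappa) * R * (pzinv kappa \ot pzinv kappa);
  xc0_inv :
    pzinv R = (kappa \ot kappa) * pzinv R * (pzinv kappa \ot pzinv kappa);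
  xc1f : \tsum_(a, b <- R) (b * kappa * a)
    = \tsum_(a, b <- R) (a * pzinv kappa * b);
  xc2c : 1 \ot pzinv kappa
    = \tsum_(a, b <- R) \tsum_(a', b' <- pzinv R)
        (a * a') \ot (b' * pzinv kappa * b);
  xc2d : kappa \ot 1
    = \tsum_(a, b <- R) \tsum_(a', b' <- pzinv R)
        (a' * kappa * a) \ot (b * b');
  xc3 : tensor12 R * tensor13 R * tensor23 R
    = tensor23 R * tensor13 R * tensor12 R
}.

(* Main.v *)
(* For a quasitriangular R, applying the counit, S and S^-1 to the two hexagon
   identities gives (counit \ot id) R = 1, then R^-1 = (S \ot id) R
   = (id \ot S^-1) R, and hence (S \ot S) R = R.  The Drinfeld element u
   satisfies u x = S^2(x) u, so it is invertible with inverse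
   \sum_i beta_i S^2(alpha_i).  Since S^2 is conjugation by kappa, moving kappa
   across alpha_i or beta_i turns (XC2c) and (XC2d) into the two formulas for
   R^-1, and the two sides of (XC1f) into u^-1 kappa and kappa^-1 S(u^-1), which
   agree because kappa^2 = u S(u^-1) and kappa commutes with u.  (XC0) is
   Delta^op = R Delta R^-1 at the grouplike kappa, and (XC3) is the usual
   Yang-Baxter equation. *)
Require Import Defs.
From mathcomp Require Import all_boot all_algebra.
From mathcomp Require Import boolp classical_sets.

Set Implicit Arguments.
Unset Strict Implicit.
Unset Printing Implicit Defensive.

Import GRing.Theory.
Local Open Scope ring_scope.

(** * Linear and multilinear maps between [k]-algebras *)

Section Linear.
Variable k : comPzRingType.
Implicit Types U V W X : pzAlgType k.

(** A predicate on bare functions, so that it applies to the anonymous maps occurring under sums. *)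
Definition klinear U W (f : U -> W) : Prop :=
  {morph f : x y / x + y} /\ (forall c, {morph f : x / c **: x}).

Definition kbilinear U V W (f : U -> V -> W) : Prop :=
  (forall v, klinear (f^~ v)) /\ (forall u, klinear (f u)).

Definition ktrilinear U V W X (f : U -> V -> W -> X) : Prop :=
  (forall w, kbilinear (fun u v => f u v w)) /\ (forall u v, klinear (f u v)).

Lemma kbilinear_balanced U V W (f : U -> V -> W) : kbilinear f -> is_balanced f.
Proof.
move=> [fl fr]; split=> [u u' v|u v v'|c u v]; first by rewrite (fl v).1.
  by rewrite (fr u).1.
by rewrite (fl v).2 (fr u).2.
Qed.

Lemma klinear0 U W (f : U -> W) : klinear f -> f 0 = 0.
Proof. by move=> [fD _]; apply: (addrI (f 0)); rewrite -fD !addr0. Qed.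

Lemma klinear_sum U W (f : U -> W) I (r : seq I) (F : I -> U) :
  klinear f -> f (\sum_(i <- r) F i) = \sum_(i <- r) f (F i).
Proof. by move=> fl; apply: (big_morph f fl.1 (klinear0 fl)). Qed.

Lemma raddf_tsum U V W X (g : W -> X) (f : U -> V -> W) (x : U \ot V) :
  klinear g -> g (tsum f x) = \tsum_(a, b <- x) g (f a b).
Proof. by move=> gl; apply: klinear_sum. Qed.

Lemma klinear_id U : klinear (fun x : U => x).
Proof. by []. Qed.

Lemma klinear_comp U V W (g : V -> W) (f : U -> V) :
  klinear g -> klinear f -> klinear (fun x => g (f x)).
Proof.
by move=> [gD gZ] [fD fZ]; split=> [x y|c x]; rewrite ?fD ?gD ?fZ ?gZ.
Qed.

Lemma klinear_mull U W (f : U -> W) a : klinear f -> klinear (fun x => a * f x).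
Proof.
by move=> [fD fZ]; split=> [x y|c x]; rewrite ?fD ?fZ ?mulrDr ?ascalerAr.
Qed.

Lemma klinear_mulr U W (f : U -> W) a : klinear f -> klinear (fun x => f x * a).
Proof.
by move=> [fD fZ]; split=> [x y|c x]; rewrite ?fD ?fZ ?mulrDl ?ascalerAl.
Qed.

Lemma tensZl U V c (u : U) (v : V) : c **: (u \ot v) = (c **: u) \ot v.
Proof. exact: tensor_scale_tens. Qed.

Lemma tensZr U V c (u : U) (v : V) : c **: (u \ot v) = u \ot (c **: v).
Proof. by rewrite tensZl tens_scale. Qed.

Lemma klinear_tensl U V W (f : U -> V) (w : W) :
  klinear f -> klinear (fun x => f x \ot w).
Proof.
by move=> [fD fZ]; split=> [x y|c x]; rewrite ?fD ?fZ ?tensDl ?tensZl.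
Qed.

Lemma klinear_tensr U V W (f : U -> V) (w : W) :
  klinear f -> klinear (fun x => w \ot f x).
Proof.
by move=> [fD fZ]; split=> [x y|c x]; rewrite ?fD ?fZ ?tensDr ?tensZr.
Qed.

Lemma klinear_scale U W (f : U -> W) c :
  klinear f -> klinear (fun x => c **: f x).
Proof.
move=> [fD fZ]; split=> [x y|d x]; rewrite ?fD ?fZ ?ascalerDr //.
by rewrite !ascalerA mulrC.
Qed.

(** The tensor is fixed, hence so is its chosen representative: linearity holds term by term. *)
Lemma klinear_tsum_body U V W X (f : U -> V -> W -> X) (x : U \ot V) :
  (forall a b, klinear (f a b)) -> klinear (fun w => \tsum_(a, b <- x) f a b w).
Proof.
move=> fl; split=> [w w'|c w]; rewrite /tsum ?ascaler_sum -?big_split.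
  by apply: eq_bigr => p _; rewrite (fl _ _).1.
by apply: eq_bigr => p _; rewrite (fl _ _).2.
Qed.

(** Here the representative varies with the tensor: additivity comes from balancedness, scaling from
    induction over sums of pure tensors. *)
Lemma klinear_tsum_fun U V W (f : U -> V -> W) :
  kbilinear f -> klinear (tsum f).
Proof.
move=> fbil; have fbal := kbilinear_balanced fbil.
split=> [x y|c x]; first exact: tsumD.
have tsum0 : tsum f 0 = 0 by rewrite (tsum_pi fbal [::]) big_nil.
elim/tensor_ind: x => [|u v x IHx]; first by rewrite ascaler0 tsum0 ascaler0.
rewrite ascalerDr !(tsumD fbal) IHx ascalerDr tensZl !(tsumE fbal).
by rewrite (fbil.1 v).2.
Qed.

Lemma klinear_tsum_arg U V W X (f : U -> V -> X) (g : W -> U \ot V) :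
  kbilinear f -> klinear g -> klinear (fun w => \tsum_(a, b <- g w) f a b).
Proof.
by move=> fbil; apply: klinear_comp; apply: klinear_tsum_fun.
Qed.

End Linear.

(** * Linearity of the Hopf structure maps *)

Section HopfLinear.
Variables (k : comPzRingType) (A : hopfAlgType k).
Implicit Types U W : pzAlgType k.

Lemma klinear_comul U (f : U -> A) :
  klinear f -> klinear (fun x => comul (f x) : A \ot A).
Proof. by apply: klinear_comp; split=> [x y|c x]; rewrite ?rmorphD ?comulZ. Qed.

Lemma klinear_antipode U (f : U -> A) :
  klinear f -> klinear (fun x => antipode (f x) : A).
Proof.
by apply: klinear_comp; split=> [x y|c x]; rewrite ?raddfD ?antipodeZ.
Qed.

Lemma klinear_counit U W (f : U -> A) (w : W) :
  klinear f -> klinear (fun x => (counit (f x) : k) **: w).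
Proof.
apply: (klinear_comp (g := fun x : A => (counit x : k) **: w)).
by split=> [x y|c x]; rewrite ?rmorphD ?ascalerDl ?counitZ ?ascalerA.
Qed.

End HopfLinear.

(** Follows the variable down through the expression. At a [tsum] it is sought first in the summand,
    then in the tensor summed over. *)
Ltac klin :=
  cbv beta;
  lazymatch goal with
  | |- ktrilinear _ => first [assumption | split; intros; klin]
  | |- kbilinear _ => first [assumption | split; intros; klin]
  | |- klinear _ =>
    solve
    [ assumption | refine (klinear_id _)
    | match goal with
      | gl : klinear ?g |- klinear (fun x => ?g _) =>
        refine (klinear_comp gl _); klin
      | fl : kbilinear ?f |- _ =>
        first [ refine (klinear_comp (fl.1 _) _); klin
              | refine (klinear_comp (fl.2 _) _); klin ]
      | fl : ktrilinear ?f |- _ =>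
        first [ refine (klinear_comp ((fl.1 _).1 _) _); klin
              | refine (klinear_comp ((fl.1 _).2 _) _); klin
              | refine (klinear_comp (fl.2 _ _) _); klin ]
      end
    | refine (klinear_antipode _); klin
    | refine (klinear_comul _); klin
    | refine (klinear_tensl _ _); klin
    | refine (klinear_tensr _ _); klin
    | refine (klinear_mull _ _); klin
    | refine (klinear_mulr _ _); klin
    | refine (klinear_counit _ _); klin
    | refine (klinear_scale _ _); klin
    | refine (klinear_tsum_body _ _); intros; klin
    | refine (klinear_tsum_arg _ _); klin ]
  end.

(** * Evaluation of sums over tensors *)

Section TensorSums.
Variable k : comPzRingType.
Implicit Types U V W X Y : pzAlgType k.

Lemma tsum_tens U V W (f : U -> V -> W) u v :
  kbilinear f -> tsum f (u \ot v) = f u v.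
Proof. by move/kbilinear_balanced=> fbal; rewrite (tsumE fbal). Qed.

Lemma eq_tsum U V W (f g : U -> V -> W) (x : U \ot V) :
  (forall u v, f u v = g u v) -> tsum f x = tsum g x.
Proof. by move=> fg; apply: eq_bigr => p _; rewrite fg. Qed.

Lemma tsum_tsum U V W X Y (f : U -> V -> W) (g : X -> Y -> U \ot V)
    (x : X \ot Y) :
  kbilinear f -> tsum f (tsum g x) = \tsum_(a, b <- x) tsum f (g a b).
Proof. by move=> fl; rewrite raddf_tsum //; apply: klinear_tsum_fun. Qed.

Lemma tsum_exchange U V W X Y (f : U -> V -> W -> X -> Y) (x : U \ot V)
    (y : W \ot X) :
  \tsum_(a, b <- x) \tsum_(c, d <- y) f a b c d =
  \tsum_(c, d <- y) \tsum_(a, b <- x) f a b c d.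
Proof. exact: exchange_big. Qed.

Lemma tsum_id U V (x : U \ot V) : \tsum_(a, b <- x) a \ot b = x.
Proof. exact/esym/tens_sum. Qed.

Lemma tsum_map U V W X Y (f : U -> V -> W) (g : X -> U) (h : Y -> V)
    (x : X \ot Y) : kbilinear f ->
  tsum f (tensor_map g h x) = \tsum_(a, b <- x) f (g a) (h b).
Proof.
move=> fl; rewrite /tensor_map tsum_tsum //.
by apply: eq_tsum => a b; rewrite tsum_tens.
Qed.

Lemma tsum_flip U V W (f : U -> V -> W) (x : V \ot U) : kbilinear f ->
  tsum f (tensor_flip x) = \tsum_(a, b <- x) f b a.
Proof.
move=> fl; rewrite /tensor_flip tsum_tsum //.
by apply: eq_tsum => a b; rewrite tsum_tens.
Qed.

Lemma tsum_mul U V W (f : U -> V -> W) (x y : U \ot V) : kbilinear f ->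
  tsum f (x * y) = \tsum_(a, b <- x) \tsum_(c, d <- y) f (a * c) (b * d).
Proof.
move=> fl; rewrite [x * y]/(tensor_mul x y) /tensor_mul tsum_tsum //.
apply: eq_tsum => a b; rewrite tsum_tsum //.
by apply: eq_tsum => c d; rewrite tsum_tens.
Qed.

Lemma tsum_assoc U V W X (f : U \ot V -> W -> X) (x : U \ot (V \ot W)) :
  kbilinear f ->
  tsum f (tensor_assoc x) =
  \tsum_(a, y <- x) \tsum_(b, c <- y) f (a \ot b) c.
Proof.
move=> fl; rewrite /tensor_assoc tsum_tsum //.
apply: eq_tsum => a y; rewrite tsum_tsum //.
by apply: eq_tsum => b c; rewrite tsum_tens.
Qed.

(** Lets [f] be evaluated on [(U \ot V) \ot W], the kind of type in which coassociativity and the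
    hexagons are stated. *)
Lemma ktrilinear_tsum U V W X (f : U -> V -> W -> X) : ktrilinear f ->
  kbilinear (fun y w => \tsum_(a, b <- y) f a b w).
Proof. by move=> fl; klin. Qed.

End TensorSums.

(** * Sweedler calculus and anti-multiplicativity of the antipode *)

Section Antipode.
Variables (k : comPzRingType) (A : hopfAlgType k).
Implicit Types W : pzAlgType k.
Local Notation S := (@antipode k A).

Lemma tsum_comulA W (f : A -> A -> A -> W) (x : A) : ktrilinear f ->
  \tsum_(y, c <- comul x) \tsum_(a, b <- comul y) f a b c =
  \tsum_(a, y <- comul x) \tsum_(b, c <- comul y) f a b c.
Proof.
move=> fl; have Fl := ktrilinear_tsum fl.
have := congr1 (tsum (fun y w => \tsum_(a, b <- y) f a b w)) (comulA x).
rewrite tsum_map // tsum_assoc // => ->.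
rewrite tsum_map; last by klin.
by apply: eq_tsum => a y; apply: eq_tsum => b c; rewrite tsum_tens //; klin.
Qed.

Lemma antipode1 : S 1 = 1.
Proof.
have := antipodel (1 : A).
rewrite !rmorph1 ascale1r tsum_tens; last by klin.
by rewrite mulr1.
Qed.

(** This and the next three are the counit and antipode axioms under a linear map; right to left,
    they expand a term into a Sweedler sum. *)
Lemma tsum_counitl W (f : A -> W) (x : A) : klinear f ->
  \tsum_(a, b <- comul x) (counit a : k) **: f b = f x.
Proof.
move=> fl; rewrite -[in RHS](comul_counitl x) raddf_tsum //.
by apply: eq_tsum => a b; rewrite fl.2.
Qed.

Lemma tsum_counitr W (f : A -> W) (x : A) : klinear f ->
  \tsum_(a, b <- comul x) (counit b : k) **: f a = f x.
Proof.
move=> fl; rewrite -[in RHS](comul_counitr x) raddf_tsum //.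
by apply: eq_tsum => a b; rewrite fl.2.
Qed.

Lemma tsum_antipodel W (f : A -> W) (x : A) : klinear f ->
  \tsum_(a, b <- comul x) f (S a * b) = (counit x : k) **: f 1.
Proof. by move=> fl; rewrite -fl.2 -antipodel raddf_tsum. Qed.

Lemma tsum_antipoder W (f : A -> W) (x : A) : klinear f ->
  \tsum_(a, b <- comul x) f (a * S b) = (counit x : k) **: f 1.
Proof. by move=> fl; rewrite -fl.2 -antipoder raddf_tsum. Qed.

(* In the convolution algebra of bilinear maps A * A -> A, both
   (x, y) |-> S (x * y) and (x, y) |-> S y * S x are inverse to the product. *)
Lemma antipodeM (x y : A) : S (x * y) = S y * S x.
Proof.
(* In Sweedler notation, S(x1 y1) x2 y2 S(y3) S(x3). Contracting from the right gives S(x y), from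
   the left S(y) S(x). *)
pose T := \tsum_(a, u <- comul x) \tsum_(b1, b2 <- comul u)
  \tsum_(c, v <- comul y) \tsum_(d1, d2 <- comul v)
  S (a * c) * (b1 * (d1 * S d2) * S b2).
transitivity T.
  rewrite -(tsum_counitr (f := fun a => S (a * y))) //; last by klin.
  apply: eq_tsum => a u.
  rewrite -[S _]mulr1 -(tsum_antipoder (f := fun b => S (a * y) * b));
    last by klin.
  apply: eq_tsum => b1 b2.
  rewrite -(tsum_counitr (f := fun c => S (a * c) * _)); last by klin.
  apply: eq_tsum => c v.
  rewrite -[b1 in LHS]mulr1.
  rewrite -(tsum_antipoder (f := fun d => S (a * c) * (b1 * d * S b2))) //.
  by klin.
rewrite /T -(tsum_comulA (f := fun a b1 b2 => \tsum_(c, v <- comul y)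
  \tsum_(d1, d2 <- comul v) S (a * c) * (b1 * (d1 * S d2) * S b2)));
  last by klin.
rewrite -(tsum_counitl (f := fun b => S y * S b)); last by klin.
apply: eq_tsum => u b2.
rewrite -(tsum_counitl (f := fun d => S d * S b2)); last by klin.
transitivity (\tsum_(a, b1 <- comul u) \tsum_(w, d2 <- comul y)
    \tsum_(c, d1 <- comul w) S (a * c) * (b1 * (d1 * S d2) * S b2)).
  apply: eq_tsum => a b1; rewrite -(tsum_comulA (f := fun c d1 d2 =>
    S (a * c) * (b1 * (d1 * S d2) * S b2))) //.
  by klin.
rewrite tsum_exchange raddf_tsum; last by klin.
(* The two counits merge into that of [u * w]; multiplicativity of [comul] then makes the antipode
   axiom for [u * w] contract both pairs at once. *)
apply: eq_tsum => w d2; rewrite ascalerA -rmorphM.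
rewrite -[S d2 * _]mul1r -(tsum_antipodel (f := fun z => z * (S d2 * S b2)));
  last by klin.
rewrite rmorphM tsum_mul; last by klin.
by apply: eq_tsum => a b1; apply: eq_tsum => c d1; rewrite !mulrA.
Qed.

Lemma klinear_antipode_inv Si : cancel S Si -> cancel Si S -> klinear Si.
Proof.
by move=> SK SiK; split=> [x y|c x]; apply: (can_inj SK);
  rewrite ?raddfD ?antipodeZ !SiK.
Qed.

Lemma antipode_invM Si : cancel S Si -> cancel Si S ->
  forall x y, Si (x * y) = Si y * Si x.
Proof. by move=> SK SiK x y; apply: (can_inj SK); rewrite antipodeM !SiK. Qed.

End Antipode.

(** * Quasi-triangular structures: counit, inverse and antipode of R *)

Section Quasitriangular.
Variables (k : comPzRingType) (A : hopfAlgType k) (R : A \ot A).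
Hypothesis Rqt : is_quasitriangular R.
Implicit Types W : pzAlgType k.
Local Notation S := (@antipode k A).

(** In R13 R23 only the third legs multiply. *)
Lemma qt_tsum_comull W (f : A -> A -> A -> W) : ktrilinear f ->
  \tsum_(y, c <- R) \tsum_(a, b <- comul y) f a b c =
  \tsum_(a, b <- R) \tsum_(c, d <- R) f a c (b * d).
Proof.
move=> fl; have Fl := ktrilinear_tsum fl.
have := congr1 (tsum (fun y w => \tsum_(a, b <- y) f a b w)) (qt_comull Rqt).
rewrite tsum_map // => ->.
rewrite tsum_mul // /tensor13 /tensor23 tsum_tsum; last by klin.
apply: eq_tsum => a b; rewrite tsum_tens; last by klin.
rewrite tsum_tsum; last by klin.
apply: eq_tsum => c d; rewrite tsum_tens; last by klin.
by rewrite tens_mulE mulr1 mul1r tsum_tens; last by klin.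
Qed.

(** In R13 R12 only the first legs multiply; the middle leg comes from the second copy of R. *)
Lemma qt_tsum_comulr W (f : A -> A -> A -> W) : ktrilinear f ->
  \tsum_(a, y <- R) \tsum_(b, c <- comul y) f a b c =
  \tsum_(a, b <- R) \tsum_(c, d <- R) f (a * c) d b.
Proof.
move=> fl; have Fl := ktrilinear_tsum fl.
have := congr1 (tsum (fun y w => \tsum_(a, b <- y) f a b w)) (qt_comulr Rqt).
rewrite tsum_assoc // tsum_map; last by klin.
rewrite tsum_mul // /tensor13 /tensor12 tsum_tsum; last by klin.
under eq_tsum => a y do under eq_tsum => b c do
  [rewrite tsum_tens; last by klin].
move=> ->; apply: eq_tsum => a b; rewrite tsum_tens; last by klin.
rewrite tsum_tens; last by klin.
rewrite mulr1 tsum_mul; last by klin.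
rewrite tsum_tens; last by klin.
by apply: eq_tsum => c d; rewrite mul1r.
Qed.

Lemma qt_comul_flip (x : A) : tensor_flip (comul x) * R = R * comul x.
Proof.
have [_ RK] := pzinvP (qt_invertible Rqt).
by rewrite (qt_comul_op Rqt) -[_ * R]mulrA RK mulr1.
Qed.

Lemma qt_tsum_flip W (f : A -> A -> W) (x : A) : kbilinear f ->
  \tsum_(y, z <- comul x) \tsum_(a, b <- R) f (a * y) (b * z) =
  \tsum_(y, z <- comul x) \tsum_(a, b <- R) f (z * a) (y * b).
Proof.
move=> fl; have := congr1 (tsum f) (qt_comul_flip x).
rewrite !tsum_mul // tsum_flip; last by klin.
by move=> fE; rewrite tsum_exchange -fE.
Qed.

(** The counit on the first leg of the first hexagon gives R = (1 ⊗ e) R, where e is the left side;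
    R cancels. *)
Lemma counit_Rl : \tsum_(a, b <- R) (counit a : k) **: b = 1.
Proof.
have [RK _] := pzinvP (qt_invertible Rqt).
set e := tsum _ _.
have eR : (1 \ot e) * R = R.
  rewrite -[RHS]tsum_id.
  transitivity (\tsum_(y, c <- R) \tsum_(a, b <- comul y)
      (counit a : k) **: (b \ot c)); last first.
    apply: eq_tsum => a b.
    by apply: (tsum_counitl (f := fun a => a \ot b)); klin.
  rewrite qt_tsum_comull; last by klin.
  rewrite -[X in X = _]tsum_id tsum_mul; last by klin.
  rewrite tsum_tens; last by klin.
  rewrite [RHS]tsum_exchange.
  apply: eq_tsum => c d; rewrite mul1r /e.
  rewrite (raddf_tsum (g := fun x => c \ot (x * d))); last by klin.
  apply: eq_tsum => a b.
  by rewrite tensZr ascalerAl.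
have e1 : 1 \ot e = 1 :> (A \ot A).
  by rewrite -[LHS]mulr1 -RK mulrA eR.
(* The counit splits the map sending e to [1 \ot e], so e can be read off. *)
have := congr1 (tsum (fun a b => (counit a : k) **: b)) e1.
rewrite !tsum_tens; try by klin.
by rewrite rmorph1 !ascale1r.
Qed.

(** Mirror image of [counit_Rl]: the counit is applied to the last leg of the second hexagon. *)
Lemma counit_Rr : \tsum_(a, b <- R) (counit b : k) **: a = 1.
Proof.
have [RK _] := pzinvP (qt_invertible Rqt).
set e := tsum _ _.
have eR : (e \ot 1) * R = R.
  rewrite -[RHS]tsum_id.
  transitivity (\tsum_(a, y <- R) \tsum_(b, c <- comul y)
      (counit c : k) **: (a \ot b)); last first.
    apply: eq_tsum => a y.
    by apply: (tsum_counitr (f := fun b => a \ot b)); klin.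
  rewrite qt_tsum_comulr; last by klin.
  rewrite -[X in X = _]tsum_id tsum_mul; last by klin.
  rewrite tsum_tens; last by klin.
  rewrite [RHS]tsum_exchange.
  apply: eq_tsum => c d; rewrite mul1r /e.
  rewrite (raddf_tsum (g := fun x => (x * c) \ot d)); last by klin.
  apply: eq_tsum => a b.
  by rewrite tensZl ascalerAl.
have e1 : e \ot 1 = 1 :> (A \ot A).
  by rewrite -[LHS]mulr1 -RK mulrA eR.
have := congr1 (tsum (fun a b => (counit b : k) **: a)) e1.
rewrite !tsum_tens; try by klin.
by rewrite rmorph1 !ascale1r.
Qed.

Lemma qt_inverse_mull (x : A \ot A) : x * R = 1 -> pzinv R = x.
Proof.
have [RK _] := pzinvP (qt_invertible Rqt).
by move=> xR; rewrite -[x]mulr1 -RK mulrA xR mul1r.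
Qed.

(** The sum is (S ⊗ id)(R) R. By the first hexagon it is a sum of S(y1) y2 ⊗ c, which the antipode
    axiom reduces to [counit_Rl]. *)
Lemma tsum_antipodel_R :
  \tsum_(a, b <- R) \tsum_(c, d <- R) (S a * c) \ot (b * d) = 1.
Proof.
rewrite -(qt_tsum_comull (f := fun a b c => (S a * b) \ot c)); last by klin.
transitivity (1 \ot \tsum_(a, b <- R) (counit a : k) **: b : A \ot A).
  rewrite raddf_tsum; last by klin.
  apply: eq_tsum => a c.
  rewrite (tsum_antipodel (f := fun y => y \ot c)); last by klin.
  by rewrite tensZr.
by rewrite counit_Rl.
Qed.

(** The second legs multiply in the opposite order, so this is not a product in [A \ot A]; it serves
    to invert the Drinfeld element. *)
Lemma tsum_antipoder_R :
  \tsum_(a, b <- R) \tsum_(c, d <- R) (a * c) \ot (d * S b) = 1.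
Proof.
rewrite -(qt_tsum_comulr (f := fun a b c => a \ot (b * S c))); last by klin.
transitivity (\tsum_(a, b <- R) ((counit b : k) **: a) \ot 1 : A \ot A).
  apply: eq_tsum => a b.
  rewrite (tsum_antipoder (f := fun y => a \ot y)); last by klin.
  by rewrite tensZl.
rewrite -(raddf_tsum (g := fun x => x \ot 1)); last by klin.
by rewrite counit_Rr.
Qed.

Lemma pzinv_R_antipode : pzinv R = tensor_map S id R.
Proof.
apply: qt_inverse_mull; rewrite -[LHS]tsum_id tsum_mul; last by klin.
rewrite tsum_map; last by klin.
exact: tsum_antipodel_R.
Qed.

Section InverseAntipode.
Variable Si : A -> A.
Hypotheses (SK : cancel S Si) (SiK : cancel Si S).
Let Sil : klinear Si := klinear_antipode_inv SK SiK.

(** As S^-1 reverses products, S^-1(b2) b1 = S^-1(S(b1) b2), and the antipode axiom applies under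
    S^-1. *)
Lemma tsum_antipode_inv_R :
  \tsum_(a, b <- R) \tsum_(c, d <- R) (a * c) \ot (Si b * d) = 1.
Proof.
have Si1 : Si 1 = 1 by rewrite -[X in Si X](antipode1 A) SK.
rewrite -(qt_tsum_comulr (f := fun a b c => a \ot (Si c * b))); last by klin.
transitivity (\tsum_(a, b <- R) ((counit b : k) **: a) \ot 1 : A \ot A).
  apply: eq_tsum => a b; rewrite -tensZl -Si1.
  rewrite -(tsum_antipodel (f := fun y => a \ot Si y)); last by klin.
  by apply: eq_tsum => c d; rewrite (antipode_invM SK SiK) SK.
rewrite -(raddf_tsum (g := fun x => x \ot 1)); last by klin.
by rewrite counit_Rr.
Qed.

Lemma pzinv_R_antipode_inv : pzinv R = tensor_map id Si R.
Proof.
apply: qt_inverse_mull; rewrite -[LHS]tsum_id tsum_mul; last by klin.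
rewrite tsum_map; last by klin.
exact: tsum_antipode_inv_R.
Qed.

End InverseAntipode.

(** Apply id ⊗ S to the two formulas for R^-1 and compare. *)
Lemma R_antipode : tensor_map S S R = R.
Proof.
have [Si SK SiK] := @antipode_bij k A.
transitivity (tensor_map id S (pzinv R)).
  rewrite pzinv_R_antipode [RHS]/tensor_map tsum_map //.
  by klin.
rewrite (pzinv_R_antipode_inv SK SiK) /tensor_map tsum_tsum; last by klin.
rewrite -[RHS]tsum_id; apply: eq_tsum => a b.
by rewrite tsum_tens ?SiK //; klin.
Qed.

Lemma tsum_R_antipode W (f : A -> A -> W) : kbilinear f ->
  \tsum_(a, b <- R) f (S a) (S b) = tsum f R.
Proof. by move=> fl; rewrite -[in RHS]R_antipode tsum_map. Qed.

(** * The Drinfeld element and the Yang-Baxter equation *)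

Local Notation u := (drinfeld R).

Lemma drinfeld_conj (x : A) : u * x = S (S x) * u.
Proof.
(* T is S^2(x3) S(b x2) a x1. Contracting S^2(x3) S(x2) = S(x2 S(x3)) gives u x; moving R across
   [comul] first gives S(b) S(x1) x2 a, which contracts to u. *)
pose T := \tsum_(y, x3 <- comul x) \tsum_(x1, x2 <- comul y)
  \tsum_(a, b <- R) S (S x3) * (S (b * x2) * (a * x1)).
transitivity T.
  rewrite /T (tsum_comulA (f := fun x1 x2 x3 =>
    \tsum_(a, b <- R) S (S x3) * (S (b * x2) * (a * x1)))); last by klin.
  rewrite -(tsum_counitr (f := fun x => u * x)); last by klin.
  apply: eq_tsum => x1 y.
  rewrite -[u * x1]mul1r -(antipode1 A).
  rewrite -(tsum_antipoder (f := fun z => S z * (u * x1))); last by klin.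
  apply: eq_tsum => x2 x3; rewrite /drinfeld.
  rewrite (raddf_tsum (g := fun z => S (x2 * S x3) * (z * x1))); last by klin.
  by apply: eq_tsum => a b; rewrite !antipodeM !mulrA.
rewrite /T -(tsum_counitl (f := fun x => S (S x) * u)); last by klin.
apply: eq_tsum => y x3.
rewrite (qt_tsum_flip (f := fun p q => S (S x3) * (S q * p))); last by klin.
rewrite tsum_exchange /drinfeld.
rewrite (raddf_tsum (g := fun z => (counit y : k) **: (S (S x3) * z)));
  last by klin.
apply: eq_tsum => a b; rewrite -[a in RHS]mul1r.
rewrite -(tsum_antipodel (f := fun z => S (S x3) * (S b * (z * a))));
  last by klin.
by apply: eq_tsum => x1 x2; rewrite antipodeM !mulrA.
Qed.

(** Multiplying the second leg by the first in [tsum_antipoder_R] gives d S(b) a c, whose inner sum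
    is u. *)
Lemma tsum_mul_drinfeld : \tsum_(a, b <- R) (b * u * a) = 1.
Proof.
have := congr1 (tsum (fun p q => q * p)) tsum_antipoder_R.
rewrite tsum_tens ?mulr1; last by klin.
move=> <-; rewrite tsum_exchange tsum_tsum; last by klin.
apply: eq_tsum => c d; rewrite tsum_tsum; last by klin.
rewrite /drinfeld (raddf_tsum (g := fun z => d * z * c)); last by klin.
apply: eq_tsum => a b; rewrite tsum_tens ?mulrA //.
by klin.
Qed.

(** By [drinfeld_conj], both products reduce to the sum of b u a. One of them carries S^2 on both
    legs, removed by applying [R_antipode] twice. *)
Lemma drinfeld_inverse : is_inverse u (\tsum_(a, b <- R) (b * S (S a))).
Proof.
split; last first.
  rewrite (raddf_tsum (g := fun z => z * u)); last by klin.
  rewrite -tsum_mul_drinfeld.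
  by apply: eq_tsum => a b; rewrite -!mulrA drinfeld_conj.
rewrite raddf_tsum; last by klin.
transitivity (\tsum_(a, b <- R) (S (S b) * u * S (S a))).
  by apply: eq_tsum => a b; rewrite mulrA drinfeld_conj.
rewrite (tsum_R_antipode (f := fun a b => S b * u * S a)); last by klin.
rewrite (tsum_R_antipode (f := fun a b => b * u * a)); last by klin.
exact: tsum_mul_drinfeld.
Qed.

(** By the first hexagon R13 R23 is (Δ ⊗ id)(R). Moving R12 across it turns Δ into its opposite, and
    the flipped hexagon reads R23 R13. *)
Lemma yang_baxter :
  tensor12 R * tensor13 R * tensor23 R = tensor23 R * tensor13 R * tensor12 R.
Proof.
rewrite -mulrA -(qt_comull Rqt).
transitivity (tensor_map (fun x => tensor_flip (comul x)) id R * tensor12 R).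
  rewrite /tensor_map raddf_tsum; last by klin.
  rewrite (raddf_tsum (g := fun z => z * tensor12 R)); last by klin.
  apply: eq_tsum => a b.
  by rewrite /tensor12 !tens_mulE mul1r mulr1 qt_comul_flip.
congr (_ * _); rewrite /tensor_map /tensor23.
transitivity (\tsum_(y, c <- R) \tsum_(a, b <- comul y) (b \ot a) \ot c).
  apply: eq_tsum => y c.
  by rewrite /tensor_flip (raddf_tsum (g := fun z => z \ot c)); last by klin.
rewrite (qt_tsum_comull (f := fun a b c => (b \ot a) \ot c)); last by klin.
rewrite (raddf_tsum (g := fun z => z * tensor13 R)); last by klin.
apply: eq_tsum => a b; rewrite /tensor13 raddf_tsum; last by klin.
by apply: eq_tsum => c d; rewrite !tens_mulE mul1r mulr1.
Qed.

End Quasitriangular.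

(** * Ribbon structures and the XC axioms *)

Section Ribbon.
Variables (k : comPzRingType) (A : hopfAlgType k) (R : A \ot A) (kappa : A).
Hypotheses (Rqt : is_quasitriangular R) (Rk : is_ribbon_structure R kappa).
Local Notation S := (@antipode k A).
Local Notation kappa' := (pzinv kappa).
Local Notation u := (drinfeld R).

(* S^2(1) = 1 gives kappa * pzinv kappa = 1; even if pzinv kappa were the junk
   value kappa, this would say that kappa is its own inverse. *)
Lemma ribbon_invertible : invertible kappa.
Proof.
have := ribbon_antipode Rk 1; rewrite mulr1 !antipode1 => kk'.
have [//|ninv] := pselect (invertible kappa).
have k'E : kappa' = kappa.
  by apply: xgetPN => y yk; apply: ninv; exists y.
by exists kappa; rewrite k'E in kk'.
Qed.

Lemma ribbon_conj (x : A) : kappa * x = S (S x) * kappa.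
Proof.
have [_ k'k] := pzinvP ribbon_invertible.
by rewrite (ribbon_antipode Rk) -mulrA k'k mulr1.
Qed.

Lemma ribbon_conj_inv Si : cancel S Si -> cancel Si S ->
  forall x, kappa' * x = Si (Si x) * kappa'.
Proof.
move=> SK SiK x; have [kk' k'k] := pzinvP ribbon_invertible.
have := ribbon_conj (Si (Si x)); rewrite !SiK => kx.
by rewrite -[LHS]mulr1 -kk' mulrA -(mulrA _ x) -kx mulrA k'k mul1r.
Qed.

(** [kappa \ot kappa] is [comul kappa] and is fixed by the flip. *)
Lemma ribbon_R_comm : (kappa \ot kappa) * R = R * (kappa \ot kappa).
Proof.
rewrite -[in RHS](ribbon_grouplike Rk) -(qt_comul_flip Rqt).
rewrite (ribbon_grouplike Rk) /tensor_flip tsum_tens //.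
by klin.
Qed.

Lemma ribbon_tens_inverse :
  is_inverse (kappa \ot kappa) (kappa' \ot kappa').
Proof.
by have [kk' k'k] := pzinvP ribbon_invertible; split;
  rewrite tens_mulE ?kk' ?k'k.
Qed.

Lemma ribbon_xc0 : R = (kappa \ot kappa) * R * (kappa' \ot kappa').
Proof. by rewrite ribbon_R_comm -mulrA ribbon_tens_inverse.1 mulr1. Qed.

Lemma ribbon_xc0_inv :
  pzinv R = (kappa \ot kappa) * pzinv R * (kappa' \ot kappa').
Proof.
have [RK KR] := pzinvP (qt_invertible Rqt).
have GR : (kappa \ot kappa) * pzinv R = pzinv R * (kappa \ot kappa).
  by rewrite -[_ \ot _ in LHS]mul1r -KR -!mulrA (mulrA R) -ribbon_R_comm
    -mulrA RK mulr1.
by rewrite GR -mulrA ribbon_tens_inverse.1 mulr1.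
Qed.

Lemma ribbon_xc1f :
  \tsum_(a, b <- R) (b * kappa * a) = \tsum_(a, b <- R) (a * kappa' * b).
Proof.
have [kk' k'k] := pzinvP ribbon_invertible.
have uw := drinfeld_inverse Rqt; have u'E := pzinvE uw.
(* Conjugation by [kappa] fixes [kappa], so S^2 does too, and [drinfeld_conj] applies. *)
have ku : kappa * u = u * kappa 
  by rewrite drinfeld_conj // (ribbon_antipode Rk) -(mulrA kappa) kk' mulr1.
have [uu' u'u] := pzinvP (ex_intro _ _ uw).
have ku' : kappa * pzinv u = pzinv u * kappa.
  by rewrite -[LHS]mul1r -u'u -mulrA (mulrA u) -ku -!mulrA uu' mulr1.
transitivity (pzinv u * kappa).
  rewrite u'E (raddf_tsum (g := fun z => z * kappa)); last by klin.
  by apply: eq_tsum => a b; rewrite -!mulrA ribbon_conj.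
have -> : pzinv u * kappa = kappa' * S (pzinv u).
  have -> : S (pzinv u) = pzinv u * kappa ^+ 2.
    by rewrite (ribbon_square Rk) mulrA u'u mul1r.
  rewrite expr2 !mulrA; congr (_ * _).
  by rewrite -(mulrA kappa') -ku' mulrA k'k mul1r.
rewrite u'E raddf_tsum; last by klin.
rewrite raddf_tsum; last by klin.
(* S(b S^2(a)) = S^3(a) S(b); invariance of R under S ⊗ S then strips one S from each leg. *)
transitivity (\tsum_(a, b <- R) (kappa' * (S (S (S a)) * S b))).
  by apply: eq_tsum => a b; rewrite antipodeM.
rewrite (tsum_R_antipode Rqt (f := fun a b => kappa' * (S (S a) * b)));
  last by klin.
apply: eq_tsum => a b.
by rewrite (ribbon_antipode Rk) !mulrA k'k mul1r.
Qed.

Lemma ribbon_xc2c : 1 \ot kappa' = \tsum_(a, b <- R) \tsum_(a', b' <- pzinv R)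
  (a * a') \ot (b' * kappa' * b).
Proof.
have [Si SK SiK] := @antipode_bij k A; have Sil := klinear_antipode_inv SK SiK.
(* This map sends S^-1(b) d in the second leg to S^-1(d) S^-2(b) κ^-1 = S^-1(d) κ^-1 b, and S^-1(d)
   is a second leg of R^-1. *)
have := congr1 (tsum (fun a b => a \ot (Si b * kappa')))
  (tsum_antipode_inv_R Rqt SK SiK).
rewrite tsum_tens; last by klin.
rewrite -[X in Si X](antipode1 A) SK mul1r => <-.
rewrite tsum_tsum; last by klin.
apply: eq_tsum => a b.
rewrite tsum_tsum; last by klin.
rewrite (pzinv_R_antipode_inv Rqt SK SiK) tsum_map; last by klin.
apply: eq_tsum => c d; rewrite tsum_tens; last by klin.
by rewrite (antipode_invM SK SiK) -!mulrA (ribbon_conj_inv SK SiK).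
Qed.

Lemma ribbon_xc2d : kappa \ot 1 = \tsum_(a, b <- R) \tsum_(a', b' <- pzinv R)
  (a' * kappa * a) \ot (b * b').
Proof.
(* This map sends S(a) c in the first leg to S(c) S^2(a) κ = S(c) κ a, and S(c) is a first leg of
   R^-1. *)
have := congr1 (tsum (fun a b => (S a * kappa) \ot b)) (tsum_antipodel_R Rqt).
rewrite tsum_tens; last by klin.
rewrite antipode1 mul1r => <-.
rewrite tsum_tsum; last by klin.
apply: eq_tsum => a b.
rewrite tsum_tsum; last by klin.
rewrite (pzinv_R_antipode Rqt) tsum_map; last by klin.
apply: eq_tsum => c d; rewrite tsum_tens; last by klin.
by rewrite antipodeM -!mulrA ribbon_conj.
Qed.

End Ribbon.

Theorem proposition4p4 (k : comPzRingType) (A : hopfAlgType k)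
    (R : A \ot A) (kappa : A) :
  is_ribbon_hopf_algebra R kappa -> is_xc_algebra R kappa.
Proof.
move=> [Rqt Rk]; split.
- exact: qt_invertible Rqt.
- exact: ribbon_invertible Rk.
- exact: ribbon_xc0 Rqt Rk.
- exact: ribbon_xc0_inv Rqt Rk.
- exact: ribbon_xc1f Rqt Rk.
- exact: ribbon_xc2c Rqt Rk.
- exact: ribbon_xc2d Rqt Rk.
- exact: yang_baxter Rqt.
Qed.
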